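(* Let $F=F(S)$ be the free group over a set $S$ with $|S|\geq 2$, and let $\sigma\in\ell^\infty$. Then the map $g_\sigma:F\rightarrow\mathbb{R}$ is a quasi-morphism.
   Context: A map $f:\Gamma\to\mathbb{R}$ on a group $\Gamma$ is a quasi-morphism if $\sup_{x,y\in\Gamma}|f(x)+f(y)-f(xy)|<\infty$. An element $x\in F(S)$ is called a power if $x=s^k$ for some $s\in S$ and $k\in\mathbb{Z}$. Each non-trivial $x\in F$ has a unique shortest factorization into powers, called the factorization of $x$: $x=x_0\cdots x_n$ with $x_i=s_i^{k_i}$, $s_i\in S$, $k_i\in\mathbb{Z}\setminus\{0\}$, and $s_i\neq s_{i+1}$ for $0\le i<n$. $\ell^\infty$ is the space of bounded real sequences $\sigma=(\sigma(k))_{k\geq1}$. Each $\sigma\in\ell^\infty$ is extended to an odd function $\sigma:\mathbb{Z}\to\mathbb{R}$, i.e. $\sigma(-k)=-\sigma(k)$ and $\sigma(0)=0$. The map $g_\sigma:F\to\mathbb{R}$ is defined on powers by $g_\sigma(s^k)=\sigma(k)$, and for $x$ with factorization $x=x_0\cdots x_n$ by $g_\sigma(x)=\sum_{i=0}^n g_\sigma(x_i)$. *)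

(* Defs.v *)
From HB Require Import structures.
From mathcomp Require Import all_boot all_order all_algebra zify.
From mathcomp Require Import all_classical all_reals all_analysis.

Set Implicit Arguments.
Unset Strict Implicit.
Unset Printing Implicit Defensive.

Import Order.TTheory GRing.Theory Num.Theory.
Import numFieldNormedType.Exports.

Local Open Scope classical_set_scope.
Local Open Scope ring_scope.

Definition quasi_morphism (R : realType) (G : groupType) (f : G -> R) : Prop :=
  (ereal_sup [set `|f p.1 + f p.2 - f (p.1 * p.2)%g|%:E | p in [set: G * G]]
    < +oo)%E.

Section Words.
Variable S : choiceType.

(* [(s, false)] stands for the generator s, [(s, true)] for its inverse. *)
Definition letter := (S * bool)%type.
Implicit Types (a b : letter) (u v w : seq letter).

Definition linv a : letter := (a.1, ~~ a.2).
Definition reduced w := sorted (fun a b => b != linv a) w.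

Definition push a w :=
  if w is b :: w' then if b == linv a then w' else a :: w else [:: a].

Definition wmul u v := foldr push v u.
Definition winv w := rev (map linv w).

Lemma linvK : involutive linv.
Proof. by case=> s b; rewrite /linv /= negbK. Qed.

Lemma reduced_push a w : reduced w -> reduced (push a w).
Proof.
case: w => [|b w] //= rw; case: eqP => [_|/eqP ab /=]; last by rewrite ab.
exact: path_sorted rw.
Qed.

Lemma reduced_wmul u v : reduced v -> reduced (wmul u v).
Proof. by move=> rv; elim: u => //= a u; exact: reduced_push. Qed.

Lemma pushK a w : reduced w -> push (linv a) (push a w) = w.
Proof.
case: w => [|b w] /=; first by rewrite linvK eqxx.
case: eqP => [-> rw|_ _ /=]; last by rewrite linvK eqxx.
by case: w rw => [|c w] //= /andP[/negPf -> _].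
Qed.

Lemma push_reduced a w : reduced (a :: w) -> push a w = a :: w.
Proof. by case: w => [|b w] //= /andP[/negPf ->]. Qed.

Lemma wmul_push a v w :
  reduced w -> wmul (push a v) w = push a (wmul v w).
Proof.
case: v => [|b v] //= rw; case: eqP => [->|//].
by rewrite -[X in push X (push _ _)]linvK pushK ?reduced_wmul.
Qed.

Lemma wmulA u v w :
  reduced w -> wmul u (wmul v w) = wmul (wmul u v) w.
Proof. by move=> rw; elim: u => //= a u ->; rewrite wmul_push. Qed.

Lemma wmul_cat u v : reduced (u ++ v) -> wmul u v = u ++ v.
Proof.
elim: u => //= a u IH ruv; rewrite IH; last exact: path_sorted ruv.
exact: push_reduced.
Qed.

Lemma wmul_nil w : reduced w -> wmul w [::] = w.
Proof. by move=> rw; rewrite wmul_cat cats0. Qed.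

Lemma reduced_winv w : reduced w -> reduced (winv w).
Proof.
rewrite /reduced /winv rev_sorted sorted_map.
by apply: sub_sorted => a b /=; rewrite linvK eq_sym.
Qed.

Lemma wmulVw w : wmul (winv w) w = [::].
Proof.
elim: w => //= a w IH; rewrite /winv /= rev_cons -cats1 /wmul foldr_cat /=.
by rewrite linvK eqxx.
Qed.

Lemma winvK : involutive winv.
Proof. by move=> w; rewrite /winv map_rev revK (mapK linvK). Qed.

Lemma wmulwV w : wmul w (winv w) = [::].
Proof. by rewrite -{1}(winvK w) wmulVw. Qed.

End Words.

(* The free group F(S), as the set of reduced words. *)
Record free_group (S : choiceType) := FreeGroup {
  word :> seq (letter S);
  _ : reduced word }.

HB.instance Definition _ (S : choiceType) := [isSub for @word S].
HB.instance Definition _ (S : choiceType) := [Choice of free_group S by <:].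

Section FreeGroup.
Variable S : choiceType.
Implicit Types x y z : free_group S.

Lemma free_groupP x : reduced x. Proof. exact: valP. Qed.

Definition fone : free_group S := @FreeGroup S [::] isT.
Definition fmul x y : free_group S := FreeGroup (reduced_wmul x (free_groupP y)).
Definition finv x : free_group S := FreeGroup (reduced_winv (free_groupP x)).

Fact fmulA : associative fmul.
Proof. by move=> x y z; apply/val_inj/wmulA/free_groupP. Qed.

Fact fmul1x : left_id fone fmul.
Proof. by move=> x; apply/val_inj. Qed.

Fact fmulx1 : right_id fone fmul.
Proof. by move=> x; apply/val_inj/wmul_nil/free_groupP. Qed.

Fact fmulVx : left_inverse fone finv fmul.
Proof. by move=> x; apply/val_inj/wmulVw. Qed.

Fact fmulxV : right_inverse fone finv fmul.
Proof. by move=> x; apply/val_inj/wmulwV. Qed.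

HB.instance Definition _ :=
  isGroup.Build (free_group S) fmulA fmul1x fmulx1 fmulVx fmulxV.

Definition gen (s : S) : free_group S := @FreeGroup S [:: (s, false)] isT.

End FreeGroup.

(* x ^ k for an integer exponent k *)
Definition gpow (G : groupType) (x : G) (k : int) : G :=
  match k with Posz n => (x ^+ n)%g | Negz n => (x ^- n.+1)%g end.

Lemma gpowS (G : groupType) (x : G) k : gpow x (1 + k) = (x * gpow x k)%g.
Proof.
case: k => n; first by rewrite /= expgS.
case: n => [|n]; first by rewrite /= mulgV.
have -> : 1 + Negz n.+1 = Negz n by lia.
by rewrite /= (expgSr x n.+1) invgM mulVKg.
Qed.

Lemma gpowP (G : groupType) (x : G) k : gpow x (- 1 + k) = (x^-1 * gpow x k)%g.
Proof. by rewrite -{2}(addrNK 1 k) (addrC _ 1) gpowS mulKg addrC. Qed.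

Lemma gpowD (G : groupType) (x : G) k m :
  gpow x (k + m) = (gpow x k * gpow x m)%g.
Proof.
elim: k => [|n IH|n IH]; first by rewrite add0r mul1g.
  by rewrite -add1n PoszD -addrA gpowS IH mulgA -gpowS.
by rewrite -add1n PoszD opprD -addrA gpowP IH mulgA -gpowP.
Qed.

Section Factorization.
Variable S : choiceType.
Implicit Types (x : free_group S) (p q : S * int) (f : seq (S * int)).

(* The pair (s, k) encodes the power s ^ k. *)
Definition power p : free_group S := gpow (gen p.1) p.2.

Definition is_factorization x f : Prop :=
  [/\ x = (\prod_(p <- f) power p)%g,
      all (fun p => p.2 != 0) f &
      sorted (fun p q => p.1 != q.1) f].

(* Each letter either increments or decrements the exponent of the leading
   power, or starts a new power. *)
Definition cons_letter (a : letter S) f :=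
  let e : int := if a.2 then - 1 else 1 in
  if f is (s, k) :: f' then
    if s == a.1 then (s, e + k) :: f' else (a.1, e) :: f
  else [:: (a.1, e)].

Definition factorization x := foldr cons_letter [::] (word x).

Let normal f := all (fun p => p.2 != 0) f && sorted (fun p q => p.1 != q.1) f.
Let letters p : seq (letter S) := nseq `|p.2|%N (p.1, p.2 < 0).
Let expand f := flatten (map letters f).

Lemma word_power p : word (power p) = letters p.
Proof.
have wX s n : word (gen s ^+ n)%g = nseq n (s, false).
  elim: n => // n IH; rewrite expgS.
  transitivity (push (s, false) (word (gen s ^+ n)%g)) => //.
  rewrite IH push_reduced //; elim: n {IH} => //= n IH.
  by rewrite /linv xpair_eqE andbF.
case: p => s [n|n]; first exact: wX.
transitivity (winv (word (gen s ^+ n.+1)%g)) => //.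
by rewrite wX /winv map_nseq rev_nseq.
Qed.

Lemma letters_cons s (k : int) : k != 0 ->
  letters (s, k) = (s, k < 0) :: nseq `|k|%N.-1 (s, k < 0).
Proof. by rewrite /letters /= -absz_eq0; case: absz. Qed.

Lemma reduced_expand f : normal f -> reduced (expand f).
Proof.
elim: f => // -[s k] f IH; rewrite /normal /= => /andP[/andP[k0 nf] sf].
have {IH} := IH; rewrite /normal nf (path_sorted sf) => /(_ isT).
rewrite /expand /= letters_cons //=.
have hd : forall w, w = flatten (map letters f) -> reduced w ->
    path (fun a b => b != linv a) (s, k < 0) w.
  move=> w ->; case: f sf nf => [|[t m] f] //= /andP[st _] /andP[m0 _].
  rewrite letters_cons //= => ->; rewrite andbT.
  by rewrite /linv xpair_eqE eq_sym (negPf st).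
move=> /(hd _ erefl) {hd}; elim: (_.-1) => //= n IH /IH ->.
by rewrite /linv xpair_eqE eqxx; case: (k < 0).
Qed.

Lemma word_prod f : normal f ->
  word (\prod_(p <- f) power p)%g = expand f.
Proof.
elim: f => [|p f IH]; first by rewrite big_nil.
move=> npf; rewrite big_cons.
transitivity (wmul (word (power p)) (word (\prod_(q <- f) power q)%g)) => //.
rewrite word_power IH; last first.
  by case/andP: npf => /andP[_ nf] /path_sorted sf; apply/andP.
exact/wmul_cat/(reduced_expand npf).
Qed.

Lemma foldr_expand f : normal f -> foldr cons_letter [::] (expand f) = f.
Proof.
elim: f => // -[s k] f IH npf; rewrite /expand /= foldr_cat IH; last first.
  by case/andP: npf => /andP[_ nf] /path_sorted sf; apply/andP.
case/andP: npf => /andP[/= k0 _] sf {IH}.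
have e n b : foldr cons_letter f (nseq n.+1 (s, b)) =
    (s, if b then - n.+1%:Z else n.+1%:Z) :: f.
  elim: n => [|n IHn]; last first.
    rewrite -[LHS]/(cons_letter (s, b) (foldr cons_letter f (nseq n.+1 (s, b)))).
    rewrite IHn /cons_letter /= eqxx.
    by congr ((s, _) :: f); case: b {IHn}; lia.
  case: f sf => [|[t m] f] /=; first by case: b.
  by case/andP=> st _; rewrite /cons_letter eq_sym (negPf st); case: b.
rewrite /letters /=; by case: k k0 {sf} => [[|n]|n] // _; exact: e.
Qed.

Lemma factorizationP x : is_factorization x (factorization x).
Proof.
suff [nf ef] : normal (factorization x) /\ expand (factorization x) = x.
  have /andP[? ?] := nf; split=> //; apply/val_inj => /=.
  by rewrite word_prod // ef.
rewrite /factorization; have := free_groupP x.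
elim: (word x) => // a w IH rw; have {IH} := IH (path_sorted rw).
rewrite [foldr _ _ (a :: w)]/=.
case: (foldr _ _ w) => [|[t k] f] [nf ew].
  by rewrite -ew /=; case: a {rw} => s []; split.
have /andP[/= /andP[k0 nf'] sf] := nf.
case: a rw => s b rw; rewrite /cons_letter /=; case: eqP => [ts|/eqP ts].
  have bk : b = (k < 0).
    move: rw; rewrite -ew /expand /= letters_cons //= => /andP[].
    by rewrite /linv xpair_eqE ts eqxx /= => + _; case: b; case: (k < 0).
  split.
    have k1 : (if b then - 1 else 1) + k != 0.
      by move: k0; rewrite bk; case: ifP; lia.
    by rewrite /normal /= k1 nf'; case: (f) sf => //= q g; rewrite ts.
  rewrite -ew /expand /= -cat_cons; congr (_ ++ _).
  rewrite /letters /= ts bk.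
  have -> : `|((if k < 0 then - 1 else 1) + k)%R|%N = `|k|%N.+1.
    by case: ifP; lia.
  have -> // : ((if k < 0 then - 1 else 1) + k < 0) = (k < 0).
  by move: k0; case: ifP; lia.
split; first by rewrite /normal /= k0 nf' sf [s == t]eq_sym ts; case: b {rw}.
by rewrite -ew /expand /=; case: b {rw}.
Qed.

Lemma factorization_uniq x f : is_factorization x f -> f = factorization x.
Proof.
case=> -> nf sf; rewrite /factorization word_prod ?foldr_expand //;
exact/andP.
Qed.

Lemma factorization_power s (k : int) :
  k != 0 -> factorization (gpow (gen s) k) = [:: (s, k)].
Proof.
by move=> k0; apply/esym/factorization_uniq; split; rewrite ?big_seq1 //= k0.
Qed.

(* The factorization is the unique shortest expression as a product of powers. *)
Lemma factorization_shortest x f : x = (\prod_(p <- f) power p)%g ->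
  (size (factorization x) <= size f ?= iff (factorization x == f))%N.
Proof.
pose cons_power p g : seq (S * int) :=
  if p.2 == 0 then g else
  if g is q :: g' then
    if q.1 == p.1 then
      if p.2 + q.2 == 0 then g' else (p.1, p.2 + q.2) :: g'
    else p :: g
  else [:: p].
have consE p g : (\prod_(q <- cons_power p g) power q =
    power p * \prod_(q <- g) power q)%g.
  case: p => s k; rewrite /cons_power /=.
  case: eqP => [->|_]; first by rewrite mul1g.
  case: g => [|[t m] g] /=; first by rewrite big_seq1 big_nil mulg1.
  case: eqP => [->|_]; last by rewrite !big_cons.
  case: eqP => [km|_]; rewrite !big_cons mulgA /power /= -gpowD //.
  by rewrite km mul1g.
have cons_normal p g : normal g -> normal (cons_power p g).
  case: p => s k; rewrite /cons_power /=; case: eqP => // /eqP k0.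
  case: g => [|[t m] g]; first by rewrite /normal /= k0.
  rewrite {1}/normal /= => /andP[/andP[m0 ng] sg].
  case: eqP => [ts|/eqP ts]; last first.
    by rewrite /normal /= k0 m0 ng sg [s == t]eq_sym ts.
  case: eqP => [_|/eqP km]; first by rewrite /normal ng (path_sorted sg).
  by rewrite /normal /= km ng; case: g sg {ng} => //= q g; rewrite ts.
have cons_size p g :
    (size (cons_power p g) <= (size g).+1 ?= iff (cons_power p g == p :: g))%N.
  have neq (h : seq (S * int)) : (size h <= size g)%N ->
      (size h <= (size g).+1 ?= iff (h == p :: g))%N.
    move=> hg; split; first exact: leqW.
    rewrite ltn_eqF //; apply/esym/eqP => hE; by rewrite hE ltnn in hg.
  rewrite /cons_power; case: eqP => _; first exact: neq.
  case: g neq => [|q g] neq; first by split; rewrite ?eqxx.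
  case: ifP => _; last by split; rewrite ?eqxx.
  by case: ifP => _; apply: neq => //=.
pose nf := foldr cons_power [::].
have nfE g : (\prod_(q <- nf g) power q = \prod_(q <- g) power q)%g.
  by elim: g => //= p g IH; rewrite consE IH big_cons.
have nf_normal g : normal (nf g) by elim: g => //= p g; exact: cons_normal.
move=> xE; have -> : factorization x = nf f.
  by apply/esym/factorization_uniq; have /andP[? ?] := nf_normal f; split;
    rewrite // nfE.
elim: f {xE} => //= p g [le_g eq_g]; have [le_c eq_c] := cons_size p (nf g).
split; first exact: leq_trans le_c _.
apply/eqP/eqP => [e|->//]; have/eqP : size (nf g) = size g by lia.
rewrite eq_g => /eqP ng; rewrite -{2}ng; apply/eqP.
by rewrite -eq_c e ng.
Qed.

End Factorization.

(* [u k] is the k-th term for k >= 1; the value [u 0] is irrelevant. *)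
Definition linf (R : realType) (u : nat -> R) : Prop :=
  [bounded u k | k in [set k | (1 <= k)%N]].

Definition odd_ext (R : realType) (u : nat -> R) (k : int) : R :=
  match k with
  | Posz 0 => 0
  | Posz n => u n
  | Negz n => - u n.+1
  end.

Definition g_sigma (R : realType) (S : choiceType) (sigma : nat -> R)
    (x : free_group S) : R :=
  \sum_(p <- factorization x) odd_ext sigma p.2.

Lemma g_sigma_power (R : realType) (S : choiceType) (sigma : nat -> R)
    (s : S) (k : int) :
  g_sigma sigma (gpow (gen s) k) = odd_ext sigma k.
Proof.
rewrite /g_sigma; have [->|k0] := eqVneq k 0; first by rewrite big_nil.
by rewrite factorization_power // big_seq1.
Qed.

(* Main.v *)
Require Import Defs.
From mathcomp Require Import all_boot all_order all_algebra.
From mathcomp Require Import all_classical all_reals all_analysis.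
From mathcomp Require Import lra.

(** Why [g_sigma] is a quasi-morphism. Cancel as much as possible in a product
    [x * y]: there are words [a], [b], [c] such that, letter for letter,
    [x = a c], [y = c^-1 b] and [x * y = a b] (lemma [wmul_cancel]). In each of
    these three expressions nothing cancels, and the factorization of a
    concatenation [u v] is that of [u] followed by that of [v], except that the
    last power of [u] and the first power of [v] are merged if they have the
    same base (lemmas [glue] and [foldr_cons_letter_cat]). So if [sigma] is
    bounded by [M], then [g_sigma] is additive on each concatenation up to
    three values of [sigma], that is, up to [3 M] (lemma [weight_glue]). Since
    [sigma] is odd, [g_sigma] changes sign under inversion (lemma
    [g_sigma_inv]), so the contributions of [c] and [c^-1] cancel out, which
    leaves a defect of at most [9 M]. *)

Set Implicit Arguments.
Unset Strict Implicit.
Unset Printing Implicit Defensive.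

Import Order.TTheory GRing.Theory Num.Theory.
Local Open Scope ring_scope.

Section Glue.
Variable S : choiceType.
Implicit Types (r f : seq (S * int)) (u v w : seq (letter S)).

(** The factorization of a product in which nothing cancels: only the powers on
    the two sides of the junction can interact. *)
Fixpoint glue r f : seq (S * int) :=
  if r is p :: r' then
    if r' is [::] then
      if f is q :: f' then
        if q.1 == p.1 then (p.1, p.2 + q.2) :: f' else p :: f
      else [:: p]
    else p :: glue r' f
  else f.

(** The recursive step that computes factorizations acts on the first power
    only, hence commutes with what happens at the junction, even when the two
    places meet because [r] is a single power. *)
Lemma cons_letter_glue (l : letter S) r f :
  cons_letter l (glue r f) = glue (cons_letter l r) f.
Proof.
case: r => [|[s k] r].
  by case: f => [|[t m] f] //=; case: eqP => [->|].
case: r => [|p r] /=; last by case: ifP.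
case: f => [|[t m] f] /=; first by case: ifP.
have [<-|ts] := eqVneq t s; rewrite /cons_letter /=; case: ifP => //= ta.
- by rewrite eqxx addrA.
- by rewrite eqxx.
- by rewrite (negPf ts).
- by rewrite (negPf ts).
Qed.

Lemma foldr_cons_letter_cat u v :
  foldr (@cons_letter S) [::] (u ++ v) =
  glue (foldr (@cons_letter S) [::] u) (foldr (@cons_letter S) [::] v).
Proof. by elim: u => //= l u ->; exact: cons_letter_glue. Qed.

(** Multiply the letters of [u] onto [v] from right to left. Each letter either
    cancels or survives; since [u] is reduced, a letter that survives does not
    cancel the next one, so that all letters to its left survive as well. *)
Lemma wmul_cancel u v : reduced u ->
  exists a b c, [/\ u = a ++ c, v = winv c ++ b & wmul u v = a ++ b].
Proof.
elim: u => [|l u IH] ru; first by exists [::], v, [::].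
have [a [b [c [uE vE uvE]]]] := IH (path_sorted ru).
rewrite [wmul _ _]/= -/(wmul u v) uvE.
case: a uE {uvE} => [|d a] uE; last first.
  exists (l :: d :: a), b, c; split; rewrite ?uE //.
  by apply/ifN; move: ru; rewrite uE /= => /andP[].
case: b vE => [|d b] vE; first by exists [:: l], [::], c; rewrite uE.
rewrite /=; case: eqP => [dl|_]; last by exists [:: l], (d :: b), c; rewrite uE.
exists [::], b, (l :: c); split; rewrite ?uE // vE dl.
by rewrite /winv /= rev_cons cat_rcons.
Qed.

End Glue.

Section Weight.
Variables (R : realType) (S : choiceType) (sigma : nat -> R).
Implicit Types (r f : seq (S * int)).

Let weight f : R := \sum_(p <- f) odd_ext sigma p.2.

Lemma odd_extN (k : int) : odd_ext sigma (- k) = - odd_ext sigma k.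
Proof. by case: k => [[|n]|n] /=; rewrite ?oppr0 ?opprK. Qed.

Lemma powerN (s : S) (k : int) : power (s, - k) = (power (s, k))^-1%g.
Proof. by apply/(mulIg (power (s, k))); rewrite mulVg -gpowD addNr. Qed.

(** The factorization of [x^-1] is that of [x] read backwards with opposite
    exponents, and [sigma] is odd. *)
Lemma g_sigma_inv (x : free_group S) :
  @g_sigma R S sigma x^-1%g = - g_sigma sigma x.
Proof.
have [xE nf sf] := factorizationP x.
pose h (p : S * int) := (p.1, - p.2).
have -> : @g_sigma R S sigma x^-1%g = weight (rev (map h (factorization x))).
  rewrite /g_sigma; congr weight; apply/esym/factorization_uniq; split.
  - rewrite [in LHS]xE; elim: (factorization x) => [|[s k] f IH].
      by rewrite !big_nil invg1.
    by rewrite /= rev_cons -cats1 big_cat big_seq1 big_cons invgM IH powerN.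
  - by rewrite all_rev all_map; apply: sub_all nf => p /=; rewrite oppr_eq0.
  - rewrite rev_sorted sorted_map.
    by apply: sub_sorted sf => p q /=; rewrite eq_sym.
rewrite /weight /g_sigma (perm_big _ (permEl (perm_rev _))) big_map /= -sumrN.
by apply: eq_bigr => p _; exact: odd_extN.
Qed.

Variable M : R.
Hypothesis sigmaM : forall k, `|odd_ext sigma k| <= M.

(** The merged power [s^(k + m)] replaces [s^k] and [s^m]: these are the three
    values of [sigma] in the defect, and all other terms agree. *)
Lemma weight_glue r f : `|weight (glue r f) - weight r - weight f| <= 3 * M.
Proof.
have M0 : 0 <= M := le_trans (normr_ge0 _) (sigmaM 0).
elim: r => [|[s k] r IH].
  by rewrite /weight big_nil subr0 subrr normr0 mulr_ge0.
case: r IH => [_|p r IH].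
  case: f => [|[t m] f] /=.
    by rewrite /weight big_nil subrr subr0 normr0 mulr_ge0.
  case: ifP => _; rewrite /weight !big_cons !big_nil /=; last first.
    by rewrite ler_norml; apply/andP; split; lra.
  move: (sigmaM k) (sigmaM m) (sigmaM (k + m)).
  rewrite !ler_norml => /andP[? ?] /andP[? ?] /andP[? ?].
  by apply/andP; split; lra.
rewrite -[glue (_ :: _ :: _) f]/((s, k) :: glue (p :: r) f).
move: (p :: r) IH => q; rewrite /weight !big_cons /= opprD.
by rewrite (addrACA (odd_ext sigma k)) subrr add0r.
Qed.

Lemma g_sigma_defect (x y : free_group S) :
  `|g_sigma sigma x + g_sigma sigma y - @g_sigma R S sigma (x * y)%g| <= 9 * M.
Proof.
pose G w := weight (foldr (@cons_letter S) [::] w).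
have GD u v : `|G (u ++ v) - G u - G v| <= 3 * M.
  by rewrite /G foldr_cons_letter_cat; exact: weight_glue.
have [a [b [c [xE yE xyE]]]] := wmul_cancel y (free_groupP x).
have rc : reduced c.
  by have := free_groupP x; rewrite xE => /cat_sorted2[].
have GN : G (winv c) = - G c := g_sigma_inv (FreeGroup rc).
have -> : g_sigma sigma x = G (a ++ c) by rewrite -xE.
have -> : g_sigma sigma y = G (winv c ++ b) by rewrite -yE.
have -> : @g_sigma R S sigma (x * y)%g = G (a ++ b) by rewrite -xyE.
move: (GD a c) (GD (winv c) b) (GD a b); rewrite GN !ler_norml.
by move=> /andP[? ?] /andP[? ?] /andP[? ?]; apply/andP; split; lra.
Qed.

End Weight.

Lemma linf_odd_ext (R : realType) (sigma : nat -> R) : linf sigma ->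
  exists M, forall k, `|odd_ext sigma k| <= M.
Proof.
move=> /pinfty_ex_gt0[M M0 sM]; exists M.
case=> [[|n]|n] /=; first by rewrite normr0 ltW.
  exact: sM.
by rewrite normrN; exact: sM.
Qed.

Theorem proposition2p1 (R : realType) (S : choiceType)
  (hS : exists s t : S, s != t) (sigma : nat -> R) (hsigma : linf sigma) :
  quasi_morphism (@g_sigma R S sigma).
Proof.
have [M sM] := linf_odd_ext hsigma.
apply: (@le_lt_trans _ _ (9 * M)%:E); last exact: ltry.
apply: ge_ereal_sup => _ [[x y] _ <-].
by rewrite lee_fin; exact: g_sigma_defect.
Qed.
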